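(* Let $\lambda>0$ and $R=\frac{2}{\lambda}$. Let $\Omega$ be a bounded, measurable subset of $\mathbb{R}^2$, and let $\Sigma$ be any minimizer of the functional $E(\Sigma)=\mathrm{Per}(\Sigma)+\lambda|\Sigma\vartriangle\Omega|$ over measurable subsets of $\mathbb{R}^2$. Let $B_R\subset\mathbb{R}^2$ be a ball of radius $R$. If $B_R\subset\Omega$, then $B_R\cup\Sigma$ is also a minimizer of $E$. Moreover, if $B_R\subset\Omega^c$, then $(B_R\cup\Sigma^c)^c$ is also a minimizer of $E$.
   Context: For a Lebesgue measurable set $\Sigma\subset\mathbb{R}^2$, $\mathrm{Per}(\Sigma)=\int|\nabla\chi_\Sigma|\,dx\in[0,\infty]$ is the perimeter of $\Sigma$ in $\mathbb{R}^2$ (the total variation of its characteristic function). $|\cdot|$ denotes Lebesgue measure, $\vartriangle$ is symmetric difference, and $A^c=\mathbb{R}^2\setminus A$. A minimizer of $E$ is a measurable set $\Sigma$ with $E(\Sigma)\le E(\Sigma')$ for all measurable $\Sigma'\subset\mathbb{R}^2$. Balls are Euclidean balls (open or closed; the statement is meant for either). *)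

(* Defs.v *)
From HB Require Import structures.
From mathcomp Require Import all_boot all_order all_algebra.
From mathcomp Require Import all_classical all_reals all_analysis.

Set Implicit Arguments.
Unset Strict Implicit.
Unset Printing Implicit Defensive.

Import Order.TTheory GRing.Theory Num.Theory.
Import numFieldNormedType.Exports.

Local Open Scope classical_set_scope.
Local Open Scope ring_scope.

(* The norm and topology that the library puts on [K * K] are those of the max
   norm. Topological notions (continuity, differentiability, boundedness,
   compactness) do not depend on that choice; whatever does is stated with
   [enorm]. *)
Definition enorm {K : realType} (x : K * K) : K :=
  Num.sqrt (x.1 ^+ 2 + x.2 ^+ 2).

Definition open_eball {K : realType} (c : K * K) (r : K) : set (K * K) :=
  [set x | enorm (x - c) < r].

Definition closed_eball {K : realType} (c : K * K) (r : K) : set (K * K) :=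
  [set x | enorm (x - c) <= r].

(* The product [lebesgue_measure \x lebesgue_measure] lives on the Borel sets of
   the plane; its Caratheodory extension is complete, and its domain, the
   measurable sets of [lebesgue_plane K], consists of all Lebesgue measurable
   sets. The carrier of [lebesgue_plane K] is [K * K]. *)
Definition borel_area (K : realType) :
    {measure set (measurableTypeR K * measurableTypeR K) -> \bar K} :=
  (@lebesgue_measure K \x @lebesgue_measure K)%E.

Definition lebesgue_plane (K : realType) : measurableType _ :=
  caratheodory_type ((borel_area K)^*)%mu.

Definition area (K : realType) : {measure set (lebesgue_plane K) -> \bar K} :=
  @completed_measure_extension _ _ K (borel_area K).

Definition lebesgue_measurable {K : realType} (A : set (K * K)) : Prop :=
  measurable (A : set (lebesgue_plane K)).

Definition partial1 {K : realType} (f : K * K -> K) : K * K -> K :=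
  'D_((1, 0) : K * K) f.

Definition partial2 {K : realType} (f : K * K -> K) : K * K -> K :=
  'D_((0, 1) : K * K) f.

Definition C1 {K : realType} (f : K * K -> K) : Prop :=
  [/\ forall x, differentiable f x,
      continuous (partial1 f) & continuous (partial2 f)].

Definition divergence {K : realType} (phi : K * K -> K * K) (x : K * K) : K :=
  partial1 (fst \o phi) x + partial2 (snd \o phi) x.

Definition test_field {K : realType} : set (K * K -> K * K) :=
  [set phi | [/\ C1 (fst \o phi), C1 (snd \o phi),
                 compact (closure [set x | phi x != 0]) &
                 forall x, enorm (phi x) <= 1]].

(* The distributional total variation int |grad f| of a locally integrable f. *)
Definition plane_variation {K : realType} (f : K * K -> K) : \bar K :=
  ereal_sup [set (\int[area K]_x (f x * divergence phi x)%:E)%E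
            | phi in test_field].

Definition perimeter {K : realType} (A : set (K * K)) : \bar K :=
  plane_variation (\1_A : K * K -> K).

Definition energy {K : realType} (lambda : K) (Omega Sigma : set (K * K)) :
    \bar K :=
  (perimeter Sigma + lambda%:E * area K (Sigma `+` Omega))%E.

Definition minimizer {K : realType} (lambda : K) (Omega Sigma : set (K * K)) :
    Prop :=
  lebesgue_measurable Sigma /\
  forall Sigma' : set (K * K), lebesgue_measurable Sigma' ->
    (energy lambda Omega Sigma <= energy lambda Omega Sigma')%E.

(* Main.v *)
Require Import Defs.
From HB Require Import structures.
From mathcomp Require Import all_boot all_order all_algebra.
From mathcomp Require Import all_classical all_reals all_analysis.
From mathcomp Require Import measurable_realfun lra.
Import Order.TTheory GRing.Theory Num.Theory.
Import numFieldNormedType.Exports.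
Local Open Scope classical_set_scope.
Local Open Scope ring_scope.

(* Everything rests on Per(B u S) <= Per(S) + (2/R) |B \ S| for a ball B of
   radius R and an arbitrary measurable S, proved by duality. The field
   V(x) = (x - c) / R has divergence 2/R, satisfies |V| <= 1 on B and is the
   outer normal on the boundary. Given a test field phi and smooth f_n
   increasing to the indicator of B, the field phi + f_n (V - phi) is again a
   test field. Testing S with it, using that f_n (V - phi) has total divergence
   zero and that grad f_n . (V - phi) is at most an error tending to 0 in L^1
   (grad f_n points inwards and V . nu >= phi . nu at the boundary), gives
   Per(S) >= int_(B u S) div phi - (2/R) |B \ S| in the limit.
   With lambda = 2/R and B included in Omega, the last term is exactly what the
   area term of the energy gains when S is replaced by B u S. The second
   claim is the first one for the complements of S and Omega. *)

(** * C1 functions of the plane *)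

Section calculus.
Context {K : realType}.
Implicit Types (f g : K * K -> K) (x v : K * K).

Lemma differentiable_fst x : differentiable (fst : K * K -> K) x.
Proof.
apply: (@linear_differentiable K (K * K)%type K fst) => y.
exact: cvg_fst.
Qed.

Lemma differentiable_snd x : differentiable (snd : K * K -> K) x.
Proof.
apply: (@linear_differentiable K (K * K)%type K snd) => y.
exact: cvg_snd.
Qed.

Lemma derive_fst x v : 'D_v (fst : K * K -> K) x = v.1.
Proof.
rewrite deriveE; last exact: differentiable_fst.
by rewrite (@diff_lin K (K * K)%type K fst) // => y; exact: cvg_fst.
Qed.

Lemma derive_snd x v : 'D_v (snd : K * K -> K) x = v.2.
Proof.
rewrite deriveE; last exact: differentiable_snd.
by rewrite (@diff_lin K (K * K)%type K snd) // => y; exact: cvg_snd.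
Qed.

Lemma differentiable_compR (k : K -> K) g x :
  differentiable g x -> derivable k (g x) 1 -> differentiable (k \o g) x.
Proof. by move=> dg /derivable1_diffP dk; exact: differentiable_comp. Qed.

Lemma derive_compR (k : K -> K) g x v :
  differentiable g x -> derivable k (g x) 1 ->
  'D_v (k \o g) x = derive1 k (g x) * 'D_v g x.
Proof.
move=> dg dk; rewrite deriveE; last exact: differentiable_compR.
rewrite diff_comp//; last exact/derivable1_diffP.
by rewrite /= deriv1E// deriveE// [LHS]mulrC.
Qed.

Lemma C1_continuous f : C1 f -> continuous f.
Proof. by case=> df _ _ x; exact: differentiable_continuous. Qed.

Lemma C1_derivable f x v : C1 f -> derivable f x v.
Proof. by case=> df _ _; exact: diff_derivable. Qed.

Lemma C1_cst (a : K) : C1 (fun _ : K * K => a).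
Proof.
split=> [x||].
- exact: (differentiable_cst a).
- rewrite (_ : partial1 _ = fun=> 0); first exact: cst_continuous.
  by apply/funext => x; exact: derive_cst.
- rewrite (_ : partial2 _ = fun=> 0); first exact: cst_continuous.
  by apply/funext => x; exact: derive_cst.
Qed.

Lemma C1_fst : C1 (fst : K * K -> K).
Proof.
split=> [x||].
- exact: differentiable_fst.
- rewrite (_ : partial1 _ = fun=> 1); first exact: cst_continuous.
  by apply/funext => x; exact: derive_fst.
- rewrite (_ : partial2 _ = fun=> 0); first exact: cst_continuous.
  by apply/funext => x; exact: derive_fst.
Qed.

Lemma C1_snd : C1 (snd : K * K -> K).
Proof.
split=> [x||].
- exact: differentiable_snd.
- rewrite (_ : partial1 _ = fun=> 0); first exact: cst_continuous.
  by apply/funext => x; exact: derive_snd.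
- rewrite (_ : partial2 _ = fun=> 1); first exact: cst_continuous.
  by apply/funext => x; exact: derive_snd.
Qed.

Lemma C1_deriveD f g x v : C1 f -> C1 g ->
  'D_v (fun y => f y + g y) x = 'D_v f x + 'D_v g x.
Proof. by move=> f1 g1; exact: (deriveD (C1_derivable _ _ _ f1) (C1_derivable _ _ _ g1)). Qed.

Lemma C1_deriveN f x v : C1 f -> 'D_v (fun y => - f y) x = - 'D_v f x.
Proof. by move=> f1; exact: (deriveN (C1_derivable _ _ _ f1)). Qed.

Lemma C1_deriveB f g x v : C1 f -> C1 g ->
  'D_v (fun y => f y - g y) x = 'D_v f x - 'D_v g x.
Proof. by move=> f1 g1; exact: (deriveB (C1_derivable _ _ _ f1) (C1_derivable _ _ _ g1)). Qed.

Lemma C1_deriveM f g x v : C1 f -> C1 g ->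
  'D_v (fun y => f y * g y) x = f x * 'D_v g x + g x * 'D_v f x.
Proof. by move=> f1 g1; exact: (deriveM (C1_derivable _ _ _ f1) (C1_derivable _ _ _ g1)). Qed.

Lemma C1D f g : C1 f -> C1 g -> C1 (fun x => f x + g x).
Proof.
move=> f1 g1; have [df cf1 cf2] := f1; have [dg cg1 cg2] := g1.
split=> [x||].
- by apply: (@differentiableD _ _ _ f g).
- rewrite (_ : partial1 _ = fun x => partial1 f x + partial1 g x).
    by move=> x; exact: cvgD (cf1 x) (cg1 x).
  by apply/funext => x; exact: C1_deriveD.
- rewrite (_ : partial2 _ = fun x => partial2 f x + partial2 g x).
    by move=> x; exact: cvgD (cf2 x) (cg2 x).
  by apply/funext => x; exact: C1_deriveD.
Qed.

Lemma C1M f g : C1 f -> C1 g -> C1 (fun x => f x * g x).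
Proof.
move=> f1 g1; have [df cf1 cf2] := f1; have [dg cg1 cg2] := g1.
have [cf cg] := (C1_continuous _ f1, C1_continuous _ g1).
split=> [x||].
- by apply: (@differentiableM _ _ f g).
- rewrite (_ : partial1 _ = fun x => f x * partial1 g x + g x * partial1 f x).
    move=> x; exact: cvgD (cvgM (cf x) (cg1 x)) (cvgM (cg x) (cf1 x)).
  by apply/funext => x; exact: C1_deriveM.
- rewrite (_ : partial2 _ = fun x => f x * partial2 g x + g x * partial2 f x).
    move=> x; exact: cvgD (cvgM (cf x) (cg2 x)) (cvgM (cg x) (cf2 x)).
  by apply/funext => x; exact: C1_deriveM.
Qed.

Lemma C1N f : C1 f -> C1 (fun x => - f x).
Proof.
move=> f1; rewrite (_ : (fun x => - f x) = fun x => -1 * f x).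
  by apply: C1M => //; exact: C1_cst.
by apply/funext => x; rewrite mulN1r.
Qed.

Lemma C1B f g : C1 f -> C1 g -> C1 (fun x => f x - g x).
Proof. by move=> f1 g1; apply: C1D => //; exact: C1N. Qed.

Lemma C1_comp (k : K -> K) g : (forall t, derivable k t 1) ->
  continuous (derive1 k) -> C1 g -> C1 (k \o g).
Proof.
move=> dk ck g1; have [dg cg1 cg2] := g1; have cg := C1_continuous _ g1.
have ckg : continuous (derive1 k \o g).
  by move=> x; apply: continuous_comp; [exact: cg|exact: ck].
split=> [x||].
- exact: differentiable_compR.
- rewrite (_ : partial1 _ = fun x => (derive1 k \o g) x * partial1 g x).
    by move=> x; exact: cvgM (ckg x) (cg1 x).
  by apply/funext => x; rewrite /partial1 derive_compR.
- rewrite (_ : partial2 _ = fun x => (derive1 k \o g) x * partial2 g x).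
    by move=> x; exact: cvgM (ckg x) (cg2 x).
  by apply/funext => x; rewrite /partial2 derive_compR.
Qed.

End calculus.

(** * A C1 cutoff function of one real variable *)

Section cutoff.
Context {K : realType}.
Implicit Types t : K.

(** Squaring the positive part removes its kink. Away from 0 the function agrees locally with 0 or
    with the square; at 0 its difference quotient is at most [|h|] in absolute value. *)
Lemma is_derive_sqr_pos t :
  is_derive t 1 (fun s : K => Num.max s 0 ^+ 2) (2 * Num.max t 0).
Proof.
have [t0|t0|->] := ltgtP t 0.
- rewrite mulr0.
  apply: (@near_eq_is_derive _ _ _ (cst 0)).
    near=> s; rewrite max_r ?expr0n//= ltW//.
    by near: s; exact: lt_nbhsl.
- apply: (@near_eq_is_derive _ _ _ (fun s : K => s ^+ 2)).
    near=> s; rewrite max_l// ltW//.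
    by rewrite -oppr_lt0; near: s; apply: Nlt_nbhsl; rewrite oppr_lt0.
  apply: is_derive_eq.
  by rewrite scaler1 mulr_natl.
- rewrite mulr0.
  have h : (fun h : K => h^-1 *: (((fun s : K => Num.max s 0 ^+ 2) \o shift 0) (h *: 1)
      - (fun s : K => Num.max s 0 ^+ 2) 0)) @ 0^' --> (0 : K).
    apply/cvgr0Pnorm_le => e e0; near=> h.
    rewrite /= addr0 maxxx expr0n/= subr0 scaler1 /GRing.scale/=.
    have h0 : h != 0 by near: h; exact: nbhs_dnbhs_neq.
    have hmax : Num.max h 0 ^+ 2 <= `|h| * `|h|.
      rewrite -expr2 lerXn2r ?nnegrE ?le_max ?lexx ?orbT//.
      by rewrite ge_max ler_norm normr_ge0.
    rewrite normrM normfV [`|Num.max _ _ ^+ 2|]ger0_norm ?sqr_ge0//.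
    apply: (@le_trans _ _ `|h|).
      by rewrite ler_pdivrMl ?normr_gt0.
    by near: h; apply: dnbhs0_le.
  apply: DeriveDef; first by apply/cvg_ex; exists 0.
  exact: cvg_lim h.
Unshelve. all: by end_near. Qed.

(* [1 - cutoff (n * t)] is a C1 approximation of the indicator of [0 < t]. *)
Definition cutoff t : K := (1 + Num.max t 0 ^+ 2)^-1.

Let den_gt0 t : 0 < 1 + Num.max t 0 ^+ 2.
Proof. by rewrite ltr_pwDl// sqr_ge0. Qed.

Lemma cutoff_gt0 t : 0 < cutoff t.
Proof. by rewrite invr_gt0. Qed.

Lemma cutoff_le1 t : cutoff t <= 1.
Proof. by rewrite invf_le1// lerDl sqr_ge0. Qed.

Lemma cutoff_le0 t : t <= 0 -> cutoff t = 1.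
Proof. by move=> t0; rewrite /cutoff max_r// expr0n addr0 invr1. Qed.

Lemma is_derive_cutoff t :
  is_derive t 1 cutoff (- (2 * Num.max t 0 * cutoff t ^+ 2)).
Proof.
have du : is_derive t 1 (fun s : K => 1 + Num.max s 0 ^+ 2) (2 * Num.max t 0).
  have := is_deriveD (is_derive_cst (1 : K) t 1) (is_derive_sqr_pos t).
  by rewrite add0r.
have n0 : 1 + Num.max t 0 ^+ 2 != 0 by rewrite gt_eqF.
have dd : derivable (fun s : K => 1 + Num.max s 0 ^+ 2) t 1 by case: du.
have -> : cutoff = (fun s => ((fun s : K => 1 + Num.max s 0 ^+ 2) s)^-1) by [].
apply: DeriveDef; first exact: derivableV.
rewrite (@deriveV _ _ (fun s : K => 1 + Num.max s 0 ^+ 2) t 1 n0 dd).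
rewrite (@derive_val _ _ _ _ _ _ _ du).
by rewrite scaleNr /GRing.scale/= mulrC /cutoff exprVn.
Qed.

Lemma derivable_cutoff t : derivable cutoff t 1.
Proof. by case: (is_derive_cutoff t). Qed.

Lemma derive_cutoff : (derive1 cutoff) = fun t => - (2 * Num.max t 0 * cutoff t ^+ 2).
Proof. by apply/funext => t; rewrite derive1E; case: (is_derive_cutoff t). Qed.

Lemma continuous_cutoff : continuous cutoff.
Proof.
move=> t; apply: differentiable_continuous.
exact/derivable1_diffP/derivable_cutoff.
Qed.

Lemma continuous_derive_cutoff : continuous (derive1 cutoff).
Proof.
rewrite derive_cutoff => t.
apply: cvgN; apply: cvgM.
  apply: cvgM; first exact: cvg_cst.
  apply: (@continuous_max _ _ id (cst 0)); first exact: cvg_id.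
  exact: cvg_cst.
exact: (cvgM (continuous_cutoff t) (continuous_cutoff t)).
Qed.

(* The left-hand side is the boundary term in the divergence of the damped
   field; in this form it is visibly bounded and tends to 0 along [n * t]. *)
Lemma mul_derive_cutoff t :
  - (Num.max t 0 * derive1 cutoff t) = 2 * (cutoff t * (1 - cutoff t)).
Proof.
rewrite derive_cutoff; set p := Num.max t 0.
have e : (1 + p ^+ 2) * cutoff t = 1 by rewrite mulfV// gt_eqF// den_gt0.
have -> : 1 - cutoff t = p ^+ 2 * cutoff t by lra.
by lra.
Qed.

Lemma cvg_cutoff t : 0 < t -> cutoff (n%:R * t) @[n --> \oo] --> 0.
Proof.
move=> t0.
have h n : 0 <= cutoff (n.+1%:R * t) <= t^-1 * n.+1%:R^-1.
  rewrite ltW ?cutoff_gt0//= -invfM [t * _]mulrC.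
  have nt : 0 < n.+1%:R * t by rewrite mulr_gt0.
  rewrite /cutoff max_l ?(ltW nt)// lef_pV2 ?posrE//.
    (* Completing the square gives [s <= 1 + s ^+ 2], so [cutoff s <= s^-1] for positive [s]. *)
    by have := sqr_ge0 (n.+1%:R * t - 2^-1); lra.
  by rewrite ltr_pwDl// sqr_ge0.
(* The index is shifted because the bound fails at [n = 0], where the cutoff is 1 and the inverse of
   0 is 0. *)
rewrite -(cvg_shiftS (fun n => cutoff (n%:R * t))).
apply: (@squeeze_cvgr _ _ _ _ (cst 0) (fun n => t^-1 * n.+1%:R^-1)).
- by apply: nearW => n; exact: h.
- exact: cvg_cst.
- by rewrite -(mulr0 t^-1); apply: cvgM; [exact: cvg_cst|exact: cvg_harmonic].
Qed.

End cutoff.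

(** * Lebesgue measure of the plane *)

Section plane_measure.
Context {K : realType}.
Implicit Types (f g : K * K -> K) (A U : set (K * K)).

Local Notation borel_plane := (measurableTypeR K * measurableTypeR K)%type.

(** The sigma-algebra is generated by rectangles, so an open set is written as the countable union
    of the boxes with rational corners that it contains. The max norm helps here: its balls are
    boxes. *)
Lemma open_measurable_plane U :
  open U -> measurable (U : set borel_plane).
Proof.
move=> oU.
pose box (q : (rat * rat) * (rat * rat)) : set borel_plane :=
  `]ratr q.1.1, ratr q.1.2[ `*` `]ratr q.2.1, ratr q.2.2[.
have -> : (U : set borel_plane) =
    \bigcup_q (if pselect (box q `<=` U) then box q else set0).
  apply/seteqP; split=> [[x y] Uxy|x [q _]]; last first.
    by case: pselect => // sub; exact: sub.
  have /nbhs_ballP[e /= e0 eU] : nbhs (x, y) U by exact: open_nbhs_nbhs.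
  have approx (z : K) : exists p : rat * rat,
      [/\ z - e < ratr p.1, ratr p.1 < z, z < ratr p.2 & ratr p.2 < z + e].
    have [p1] : exists q : rat, ratr q \in `]z - e, z[.
      by apply: rat_in_itvoo; rewrite ltrBlDr ltrDl.
    rewrite in_itv/= => /andP[? ?].
    have [p2] : exists q : rat, ratr q \in `]z, z + e[.
      by apply: rat_in_itvoo; rewrite ltrDl.
    by rewrite in_itv/= => /andP[? ?]; exists (p1, p2).
  have [p [p1 p2 p3 p4]] := approx x; have [q [q1 q2 q3 q4]] := approx y.
  exists (p, q) => //.
  case: pselect => [sub|].
    by split; rewrite /= in_itv/=; apply/andP.
  move=> nU; exfalso; apply: nU => -[a b] [/=]; rewrite !in_itv/= => /andP[? ?] /andP[? ?].
  by apply: eU; split; rewrite /ball/= ltr_distlC; apply/andP; split; lra.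
apply: countable_bigcupT_measurable => // q.
case: pselect => [sub|nsub]; last exact: measurable0.
by apply: measurableX; exact: measurable_itv.
Qed.

Lemma borel_lebesgue_measurable A :
  measurable (A : set borel_plane) -> lebesgue_measurable A.
Proof. exact: caratheodory_measurable_mu_ext. Qed.

Lemma areaE A : measurable (A : set borel_plane) ->
  area K A = borel_area K A.
Proof. exact: measurable_mu_extE. Qed.

Lemma continuous_borel_measurable f : continuous f ->
  measurable_fun setT (f : borel_plane -> K).
Proof.
move=> cf; apply: (measurability _ (RGenOpens.measurableE K)).
move=> _ -[_ [x [y ->]] <-]; rewrite setTI.
apply: open_measurable_plane.
by move/continuousP : cf; apply; exact: interval_open.
Qed.

Lemma continuous_plane_measurable f : continuous f ->
  measurable_fun setT (f : lebesgue_plane K -> K).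
Proof.
move=> cf _ Y mY; apply: borel_lebesgue_measurable.
exact: continuous_borel_measurable.
Qed.

Lemma norm_le_box (M : K) :
  [set x : K * K | `|x| <= M] = `[- M, M] `*` `[- M, M].
Proof.
apply/seteqP; split=> -[x y] /=; rewrite !in_itv/= -!ler_norml.
  by rewrite [X in X <= _ -> _]/Num.norm/= ge_max => /andP.
by case=> xM yM; rewrite [X in X <= _]/Num.norm/= ge_max xM yM.
Qed.

Lemma compact_norm_le (M : K) : compact [set x : K * K | `|x| <= M].
Proof. by rewrite norm_le_box; apply: compact_setX; exact: segment_compact. Qed.

(** Compact support is traded for vanishing outside a ball of the max norm, a form that survives
    sums and differentiation; [norm_compact_support] goes back. *)
Lemma compact_support_norm (T : eqType) (z : T) (phi : K * K -> T) :
  compact (closure [set x | phi x != z]) ->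
  exists M : K, forall x, M < `|x| -> phi x = z.
Proof.
move=> /compact_bounded[M [Mreal HM]]; exists (M + 1) => x Mx.
apply/eqP; apply: contraT => phix.
have xs : closure [set x | phi x != z] x by exact: subset_closure.
by have := HM (M + 1); rewrite ltrDl ltr01 => /(_ isT x xs) /=; rewrite leNgt Mx.
Qed.

Lemma norm_compact_support (T : eqType) (z : T) (phi : K * K -> T) (M : K) :
  (forall x, M < `|x| -> phi x = z) -> compact (closure [set x | phi x != z]).
Proof.
move=> phiM.
apply: (subclosed_compact (@closed_closure _ _) (compact_norm_le M)).
have cM : closed [set x : K * K | `|x| <= M].
  by apply: compact_closed (compact_norm_le M); exact: norm_hausdorff.
rewrite [X in _ `<=` X](iffLR (closure_id _) cM).
apply: closure_subset => x /= /eqP phix; rewrite leNgt.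
by apply/negP => /phiM.
Qed.

Lemma bounded_continuous_supp f (M : K) : continuous f ->
  (forall x, M < `|x| -> f x = 0) -> exists C, forall x, `|f x| <= C.
Proof.
move=> cf fM.
have /compact_bounded[C [Creal HC]] : compact (f @` [set x | `|x| <= M]).
  apply: continuous_compact (compact_norm_le M).
  exact: continuous_subspaceT.
(* Boundedness provides a bound for each number strictly above [C], hence the [+ 1]; the maximum
   with 0 serves the points outside the support. *)
exists (Num.max (C + 1) 0) => x; rewrite le_max.
have [xM|/fM ->] := leP `|x| M; last by rewrite normr0 lexx orbT.
by rewrite (HC (C + 1)) ?ltrDl//; exists x.
Qed.

Lemma area_norm_le_lty (M : K) : (area K [set x | (`|x| <= M)%R] < +oo)%E.
Proof.
rewrite norm_le_box areaE; last by apply: measurableX; exact: measurable_itv.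
rewrite [X in (X < _)%E](product_measure1E (@lebesgue_measure K) (@lebesgue_measure K)); [|exact: measurable_itv|exact: measurable_itv].
have fin : (lebesgue_measure (`[(- M)%R, M] : set K) < +oo)%E.
  by rewrite lebesgue_measure_itv/=; case: ifPn => // _; rewrite ltry.
apply: lte_mul_pinfty => //; rewrite ge0_fin_numE//.
Qed.

Lemma measurable_norm_le (M : K) : lebesgue_measurable [set x | `|x| <= M].
Proof.
apply: borel_lebesgue_measurable; rewrite norm_le_box.
by apply: measurableX; exact: measurable_itv.
Qed.

(** [f] equals its restriction to a square of finite area, on which it is bounded. *)
Lemma integrable_plane f (C M : K) :
  measurable_fun setT (f : lebesgue_plane K -> K) ->
  (forall x, `|f x| <= C) -> (forall x, M < `|x| -> f x = 0) ->
  (area K).-integrable setT (EFin \o (f : lebesgue_plane K -> K)).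
Proof.
move=> mf fC fM; have mM := measurable_norm_le M.
rewrite (_ : EFin \o _ = (EFin \o (f : lebesgue_plane K -> K)) \_ [set x | `|x| <= M]).
  apply/(integrable_mkcond _ mM); apply: measurable_bounded_integrable => //.
  - exact: area_norm_le_lty.
  - exact: measurable_funTS.
  - exists C; split; first exact: num_real.
    by move=> D CD x _ /=; exact: le_trans (fC x) (ltW CD).
apply/funext => x; rewrite patchE; case: ifPn => // /negP.
by rewrite inE /= => /negP; rewrite -ltNge => /fM /= ->.
Qed.

Lemma integrable_continuous_supp f (M : K) : continuous f ->
  (forall x, M < `|x| -> f x = 0) ->
  (area K).-integrable setT (EFin \o (f : lebesgue_plane K -> K)).
Proof.
move=> cf fM; have [C fC] := bounded_continuous_supp f M cf fM.
by apply: integrable_plane fC fM; exact: continuous_plane_measurable.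
Qed.

(** Prepares Fubini, which concerns the product measure and not its completion. The identity is
    measurable from the Lebesgue plane to the Borel plane and pushes [area] forward to [borel_area],
    so a change of variables along it moves the integral. *)
Lemma integral_area f :
  measurable_fun setT (f : borel_plane -> K) ->
  (area K).-integrable setT (EFin \o (f : lebesgue_plane K -> K)) ->
  (borel_area K).-integrable setT (EFin \o (f : borel_plane -> K)) /\
  (\int[area K]_x (f x)%:E = \int[borel_area K]_x (f x)%:E)%E.
Proof.
move=> mf intf.
pose id' : lebesgue_plane K -> borel_plane := id.
have mid : measurable_fun setT id'.
  by move=> _ Y mY; rewrite setTI; exact: borel_lebesgue_measurable.
have mEf : measurable_fun [set: borel_plane] (fun x => (f x)%:E).
  exact/measurable_EFinP.
have eqm A : measurable (A : set borel_plane) -> A `<=` setT ->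
    borel_area K A = pushforward (area K) id' A.
  by move=> mA _; rewrite /pushforward /= -areaE.
split.
  apply/integrableP; split => //.
  rewrite (eq_measure_integral (pushforward (area K) id') eqm).
  have /integrableP[//] : (pushforward (area K) id').-integrable setT
      (EFin \o (f : borel_plane -> K)).
    exact: integrable_pushforward.
rewrite (eq_measure_integral (pushforward (area K) id') eqm).
by rewrite integral_pushforward.
Qed.

End plane_measure.

(** * The divergence theorem for compactly supported C1 fields *)

Section divergence_theorem.
Context {K : realType}.
Implicit Types (f : K * K -> K) (M : K).

Lemma derive_supp f M v x : (forall y, M < `|y| -> f y = 0) -> M < `|x| ->
  'D_v f x = 0.
Proof.
move=> fM Mx; rewrite -(derive_cst (0 : K) x v); apply: near_eq_derive.
near=> y; apply: fM; near: y.
exact: (cvgr_gt `|x| (@norm_continuous _ _ x)).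
Unshelve. all: by end_near. Qed.

(** Once [h * 0] is simplified, the quotient along [(1, 0)] is that of a horizontal slice, so
    derivability and derivative both pass to slices. *)
Let quotient_slice1 f (t y : K) :
  (fun h : K => h^-1 *: ((f \o shift (t, y)) (h *: ((1, 0) : K * K)) - f (t, y))) =
  (fun h => h^-1 *: (((fun s => f (s, y)) \o shift t) (h *: 1) - f (t, y))).
Proof.
apply/funext => h; congr (_ *: (f _ - _)).
by congr (_, _); rewrite /= /GRing.scale/= mulr0 add0r.
Qed.

Lemma derivable_slice1 f (t y : K) :
  derivable f (t, y) (1, 0) -> derivable (fun s => f (s, y)) t 1.
Proof. by rewrite /derivable quotient_slice1. Qed.

Lemma derive_slice1 f (t y : K) :
  'D_1 (fun s => f (s, y)) t = partial1 f (t, y).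
Proof. by rewrite /partial1 /derive quotient_slice1. Qed.

Let quotient_slice2 f (x t : K) :
  (fun h : K => h^-1 *: ((f \o shift (x, t)) (h *: ((0, 1) : K * K)) - f (x, t))) =
  (fun h => h^-1 *: (((fun s => f (x, s)) \o shift t) (h *: 1) - f (x, t))).
Proof.
apply/funext => h; congr (_ *: (f _ - _)).
by congr (_, _); rewrite /= /GRing.scale/= mulr0 add0r.
Qed.

Lemma derivable_slice2 f (x t : K) :
  derivable f (x, t) (0, 1) -> derivable (fun s => f (x, s)) t 1.
Proof. by rewrite /derivable quotient_slice2. Qed.

Lemma derive_slice2 f (x t : K) :
  'D_1 (fun s => f (x, s)) t = partial2 f (x, t).
Proof. by rewrite /partial2 /derive quotient_slice2. Qed.

Lemma continuous_pairl (y : K) : continuous (fun t : K => (t, y)).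
Proof. by move=> t; apply: (@cvg_pair _ _ _ _ (nbhs t) (nbhs y)); [exact: cvg_id|exact: cvg_cst]. Qed.

Lemma continuous_pairr (x : K) : continuous (fun t : K => (x, t)).
Proof. by move=> t; apply: (@cvg_pair _ _ _ _ (nbhs x) (nbhs t)); [exact: cvg_cst|exact: cvg_id]. Qed.

Lemma integral_derive_supp (F : K -> K) M : (forall t, derivable F t 1) ->
  continuous (fun t => 'D_1 F t) -> (forall t, M < `|t| -> F t = 0) ->
  (forall t, M < `|t| -> 'D_1 F t = 0) ->
  (\int[lebesgue_measure]_t ('D_1 F t)%:E = 0)%E.
Proof.
(* This [a] is positive and exceeds [M] whatever the sign of [M]: the interval is nondegenerate, and
   [F] vanishes at both of its ends. *)
move=> dF cF FM dFM; pose a := `|M| + 1.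
have a0 : 0 < a by rewrite ltr_wpDl.
have Ma : M < `|a| by rewrite gtr0_norm// (le_lt_trans (ler_norm M))// ltrDl.
have Fcont : continuous F.
  by move=> t; exact/differentiable_continuous/derivable1_diffP.
have -> : (\int[lebesgue_measure]_t ('D_1 F t)%:E =
    \int[lebesgue_measure]_(t in `[(- a)%R, a]) ('D_1 F t)%:E)%E.
  rewrite [RHS]integral_mkcond; apply: eq_integral => t _.
  rewrite patchE; case: ifPn => //.
  rewrite notin_setE/= in_itv/= -ler_norml => /negP; rewrite -ltNge => ta.
  by rewrite dFM// (lt_trans _ ta)// -(gtr0_norm a0).
rewrite (@continuous_FTC2 _ _ F).
- by rewrite FM// FM ?normrN// -EFinB subrr.
- lra.
- exact: continuous_subspaceT.
- split=> [t _||]; first exact: dF.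
  + by apply: cvg_at_right_filter; exact: Fcont.
  + by apply: cvg_at_left_filter; exact: Fcont.
- by move=> t _; rewrite derive1E.
Qed.

Lemma le_norm_pair1 (x y : K) : `|x| <= `|(x, y)|.
Proof. by rewrite [X in _ <= X]/Num.norm/= le_max lexx. Qed.

Lemma le_norm_pair2 (x y : K) : `|y| <= `|(x, y)|.
Proof. by rewrite [X in _ <= X]/Num.norm/= le_max lexx orbT. Qed.

(** Fubini with the first variable innermost: each inner integral is that of the derivative of a
    compactly supported slice, hence 0. *)
Lemma integral_partial1 f M : C1 f -> (forall x, M < `|x| -> f x = 0) ->
  (\int[area K]_x (partial1 f x)%:E = 0)%E.
Proof.
move=> f1 fM; have [df cf _] := f1.
have pM x : M < `|x| -> partial1 f x = 0 by exact: derive_supp.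
have [||intf ->] := integral_area (partial1 f).
- exact: continuous_borel_measurable.
- exact: integrable_continuous_supp cf pM.
rewrite -(integral21_prod_meas1 intf); apply: integral0_eq => y _.
rewrite /fubini_G/=.
under eq_integral do rewrite -derive_slice1.
apply: (integral_derive_supp _ M) => t.
- exact/derivable_slice1/diff_derivable.
- rewrite (_ : (fun _ => _) = partial1 f \o (fun t => (t, y))).
    by apply: continuous_comp; [exact: continuous_pairl|exact: cf].
  by apply/funext => s; rewrite derive_slice1.
- by move=> Mt; apply: fM; exact: lt_le_trans (le_norm_pair1 _ _).
- by move=> Mt; rewrite derive_slice1 pM//; exact: lt_le_trans (le_norm_pair1 _ _).
Qed.

Lemma integral_partial2 f M : C1 f -> (forall x, M < `|x| -> f x = 0) ->
  (\int[area K]_x (partial2 f x)%:E = 0)%E.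
Proof.
move=> f1 fM; have [df _ cf] := f1.
have pM x : M < `|x| -> partial2 f x = 0 by exact: derive_supp.
have [||intf ->] := integral_area (partial2 f).
- exact: continuous_borel_measurable.
- exact: integrable_continuous_supp cf pM.
rewrite -(integral12_prod_meas1 intf); apply: integral0_eq => x _.
rewrite /fubini_F/=.
under eq_integral do rewrite -derive_slice2.
apply: (integral_derive_supp _ M) => t.
- exact/derivable_slice2/diff_derivable.
- rewrite (_ : (fun _ => _) = partial2 f \o (fun t => (x, t))).
    by apply: continuous_comp; [exact: continuous_pairr|exact: cf].
  by apply/funext => s; rewrite derive_slice2.
- by move=> Mt; apply: fM; exact: lt_le_trans (le_norm_pair2 _ _).
- by move=> Mt; rewrite derive_slice2 pM//; exact: lt_le_trans (le_norm_pair2 _ _).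
Qed.

Lemma integral_divergence (phi : K * K -> K * K) M :
  C1 (fst \o phi) -> C1 (snd \o phi) -> (forall x, M < `|x| -> phi x = 0) ->
  (\int[area K]_x (divergence phi x)%:E = 0)%E.
Proof.
move=> phi1 phi2 phiM; have [_ c1 _] := phi1; have [_ _ c2] := phi2.
have M1 x : M < `|x| -> (fst \o phi) x = 0 by move=> /phiM /= ->.
have M2 x : M < `|x| -> (snd \o phi) x = 0 by move=> /phiM /= ->.
rewrite /divergence.
under eq_integral do rewrite EFinD.
rewrite integralD//.
- by rewrite (integral_partial1 _ _ phi1 M1) (integral_partial2 _ _ phi2 M2) adde0.
- by apply: (integrable_continuous_supp _ M c1) => x; exact: derive_supp.
- by apply: (integrable_continuous_supp _ M c2) => x; exact: derive_supp.
Qed.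

End divergence_theorem.

(** * Balls and the calibrating field *)

(** Minus the power of [x] with respect to the circle of centre [c] and radius [R]. It describes the
    ball by the sign of a polynomial, which stays C1 at the centre, unlike [enorm]. *)
Definition ball_power {K : realType} (c : K * K) (R : K) (x : K * K) : K :=
  R * R - ((x.1 - c.1) * (x.1 - c.1) + (x.2 - c.2) * (x.2 - c.2)).

Section ball.
Context {K : realType}.
Variables (c : K * K) (R : K).
Hypothesis R0 : 0 < R.
Local Notation q := (ball_power c R).

Lemma open_eballE x : open_eball c R x <-> 0 < q x.
Proof.
rewrite /open_eball/= /enorm/= -[X in _ < X](gtr0_norm R0) -sqrtr_sqr.
by rewrite ltr_sqrt ?exprn_gt0// -subr_gt0 /ball_power -!expr2.
Qed.

Lemma closed_eballE x : closed_eball c R x <-> 0 <= q x.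
Proof.
rewrite /closed_eball/= /enorm/= -[X in _ <= X](gtr0_norm R0) -sqrtr_sqr.
by rewrite ler_sqrt ?sqr_ge0// -subr_ge0 /ball_power -!expr2.
Qed.

Lemma C1_ball_power : C1 q.
Proof.
have C1x : C1 (fun x : K * K => x.1 - c.1) by apply: C1B C1_fst (C1_cst _).
have C1y : C1 (fun x : K * K => x.2 - c.2) by apply: C1B C1_snd (C1_cst _).
by apply: C1B (C1_cst _) _; apply: C1D; apply: C1M.
Qed.

Lemma continuous_ball_power : continuous q.
Proof. exact: C1_continuous C1_ball_power. Qed.

Lemma derive_ball_power x v :
  'D_v q x = - (2 * ((x.1 - c.1) * v.1 + (x.2 - c.2) * v.2)).
Proof.
have C1x : C1 (fun x : K * K => x.1 - c.1) by apply: C1B C1_fst (C1_cst _).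
have C1y : C1 (fun x : K * K => x.2 - c.2) by apply: C1B C1_snd (C1_cst _).
rewrite /ball_power C1_deriveB ?derive_cst; [|exact: C1_cst|by apply: C1D; apply: C1M].
rewrite C1_deriveD; [|exact: C1M|exact: C1M].
rewrite !C1_deriveM// !C1_deriveB; try exact: C1_cst; try exact: C1_fst; try exact: C1_snd.
rewrite derive_fst derive_snd !derive_cst.
lra.
Qed.

Lemma open_open_eball : open (open_eball c R).
Proof.
rewrite (_ : open_eball c R = q @^-1` `]0, +oo[).
  by move/continuousP : continuous_ball_power; apply; exact: interval_open.
apply/seteqP; split=> x; first by move/open_eballE; rewrite /= in_itv/= andbT.
by rewrite /= in_itv/= andbT => /open_eballE.
Qed.

Lemma lebesgue_measurable_open_eball : lebesgue_measurable (open_eball c R).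
Proof.
apply: borel_lebesgue_measurable; apply: open_measurable_plane.
exact: open_open_eball.
Qed.

Lemma lebesgue_measurable_closed_eball :
  lebesgue_measurable (closed_eball c R).
Proof.
rewrite (_ : closed_eball c R = [set: K * K] `&` q @^-1` `[0, +oo[).
  have mq := continuous_plane_measurable _ continuous_ball_power.
  apply: (mq measurableT `[0, +oo[%classic); exact: measurable_itv.
apply/seteqP; split=> x.
  by move/closed_eballE => qx; split => //=; rewrite in_itv/= andbT.
by case=> _ /=; rewrite in_itv/= andbT => /closed_eballE.
Qed.

(** The norm here is the max norm, so one coordinate of [x - c] exceeds [R] in absolute value, and
    its square alone outweighs [R * R]. *)
Lemma ball_power_lt0 x : `|c| + R < `|x| -> q x < 0.
Proof.
move=> cRx.
have : R < `|x - c| by apply: (lt_le_trans _ (lerB_dist x c)); rewrite ltrBrDl.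
rewrite [X in _ < X -> _]/Num.norm/= lt_max => Rx.
have sqr_gt (u : K) : R < `|u| -> R * R < u * u.
  move=> Ru; rewrite -!expr2 -[u ^+ 2]real_normK ?num_real//.
  by rewrite ltrXn2r// ?ltW.
have := sqr_ge0 (x.1 - c.1); have := sqr_ge0 (x.2 - c.2).
by case/orP: Rx => /sqr_gt /=; rewrite /ball_power; lra.
Qed.

Local Notation sphere := [set x | q x = 0].

(** Each section at a fixed first coordinate has at most two points, so the product measure
    integrates 0. *)
Lemma sphere_negligible : (area K).-negligible sphere.
Proof.
have mS : measurable
    (sphere : set (measurableTypeR K * measurableTypeR K)).
  rewrite (_ : sphere = [set: K * K] `&` q @^-1` [set 0]).
    have mq := continuous_borel_measurable _ continuous_ball_power.
    by apply: (mq measurableT [set 0]); exact: measurable_set1.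
  by rewrite setTI.
exists sphere; split=> //; first exact: borel_lebesgue_measurable.
transitivity (borel_area K sphere); first exact: areaE.
rewrite /borel_area/= /product_measure1.
apply: integral0_eq => a _ /=.
apply: countable_lebesgue_measure0.
(* For a negative radicand [s] is 0, but the section is then empty: a point [b] in it makes the
   radicand equal to [(b - c.2) ^+ 2]. *)
pose s := Num.sqrt (R * R - (a - c.1) * (a - c.1)).
apply: (@sub_countable _ _ _ [set c.2 + s; c.2 - s]); last first.
  by apply: finite_set_countable.
apply: subset_card_le => b; rewrite /xsection/= inE /ball_power/= => h.
have e : (b - c.2) ^+ 2 = s ^+ 2.
  rewrite sqr_sqrtr; last by have := sqr_ge0 (b - c.2); lra.
  by lra.
by move/eqP: e; rewrite eqf_sqr => /orP[]/eqP e; [left|right]; lra.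
Qed.

End ball.

Section calibration.
Context {K : realType}.
Variables (c : K * K) (R : K).
Hypothesis R0 : 0 < R.
Local Notation q := (ball_power c R).
Variable phi : K * K -> K * K.
Hypothesis tphi : test_field phi.

Let f (n : nat) (x : K * K) : K := 1 - cutoff (n%:R * q x).

(* [f n] times [(x - c) / R - phi x]; adding it to [phi] replaces [phi] by the
   calibrating field [(x - c) / R] inside the ball. *)
Definition damped n (x : K * K) : K * K :=
  (f n x * ((x.1 - c.1) / R - (phi x).1), f n x * ((x.2 - c.2) / R - (phi x).2)).

Let f_ge0 n x : 0 <= f n x.
Proof. by rewrite subr_ge0 cutoff_le1. Qed.

Let f_le1 n x : f n x <= 1.
Proof. by rewrite gerBl ltW// cutoff_gt0. Qed.

Let f0 n x : q x <= 0 -> f n x = 0.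
Proof. by move=> qx; rewrite /f cutoff_le0 ?subrr// mulr_ge0_le0. Qed.

Let C1f n : C1 (f n).
Proof.
apply: C1B; first exact: C1_cst.
apply: (C1_comp cutoff (fun x => n%:R * q x)).
- exact: derivable_cutoff.
- exact: continuous_derive_cutoff.
- by apply: C1M; [exact: C1_cst|exact: C1_ball_power].
Qed.

Let derive_f n x v : 'D_v (f n) x =
  2 * n%:R * derive1 cutoff (n%:R * q x) *
  ((x.1 - c.1) * v.1 + (x.2 - c.2) * v.2).
Proof.
have C1nq : C1 (fun x => n%:R * q x).
  by apply: C1M; [exact: C1_cst|exact: C1_ball_power].
rewrite C1_deriveB; [|exact: C1_cst|]; last first.
  apply: (C1_comp cutoff) C1nq; first exact: derivable_cutoff.
  exact: continuous_derive_cutoff.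
rewrite derive_cst derive_compR; [|by case: C1nq|exact: derivable_cutoff].
rewrite C1_deriveM; [|exact: C1_cst|exact: C1_ball_power].
by rewrite derive_cst derive_ball_power; lra.
Qed.

Let C1radial1 : C1 (fun x : K * K => (x.1 - c.1) / R - (phi x).1).
Proof.
case: tphi => phi1 _ _ _; apply: C1B phi1.
by apply: C1M (C1_cst _); apply: C1B C1_fst (C1_cst _).
Qed.

Let C1radial2 : C1 (fun x : K * K => (x.2 - c.2) / R - (phi x).2).
Proof.
case: tphi => _ phi2 _ _; apply: C1B phi2.
by apply: C1M (C1_cst _); apply: C1B C1_snd (C1_cst _).
Qed.

Lemma C1_damped1 n : C1 (fst \o damped n).
Proof. by apply: C1M C1radial1; exact: C1f. Qed.

Lemma C1_damped2 n : C1 (snd \o damped n).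
Proof. by apply: C1M C1radial2; exact: C1f. Qed.

Lemma damped_supp n x : `|c| + R < `|x| -> damped n x = 0.
Proof. by move=> /(ball_power_lt0 _ _ R0)/ltW qx; rewrite /damped !f0// !mul0r. Qed.

Let phi_sqr_le1 x : (phi x).1 ^+ 2 + (phi x).2 ^+ 2 <= 1.
Proof.
case: tphi => _ _ _ /(_ x); rewrite /enorm -[X in _ <= X]sqrtr1.
by rewrite ler_sqrt.
Qed.

(** By the product rule the divergence is [f n x * (2 / R - divergence phi x)] plus the scalar
    product of grad [f n] with [(x - c) / R - phi]. Here grad [f n] is [2 n k (x - c)] with [k <= 0]
    the derivative of the cutoff. As [(x - c) . phi <= R] in the ball, the scalar product is at most
    [- 2 n k q / R], which [mul_derive_cutoff] turns into the [4 / R] term. *)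
Lemma divergence_damped n x : divergence (damped n) x <=
  (1 - cutoff (n%:R * q x)) * (2 / R - divergence phi x) +
  4 / R * (cutoff (n%:R * q x) * (1 - cutoff (n%:R * q x))).
Proof.
case: (tphi) => phi1 phi2 _ _.
have d1 : partial1 (fst \o damped n) x = f n x * (R^-1 - partial1 (fst \o phi) x)
    + ((x.1 - c.1) / R - (phi x).1) * partial1 (f n) x.
  rewrite /partial1 C1_deriveM; [|exact: C1f|exact: C1radial1].
  congr (_ * _ + _); rewrite C1_deriveB//; last first.
    by apply: C1M (C1_cst _); apply: C1B C1_fst (C1_cst _).
  rewrite C1_deriveM; [|by apply: C1B C1_fst (C1_cst _)|exact: C1_cst].
  rewrite C1_deriveB; [|exact: C1_fst|exact: C1_cst].
  by rewrite derive_fst !derive_cst/= subr0 mulr0 add0r mulr1.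
have d2 : partial2 (snd \o damped n) x = f n x * (R^-1 - partial2 (snd \o phi) x)
    + ((x.2 - c.2) / R - (phi x).2) * partial2 (f n) x.
  rewrite /partial2 C1_deriveM; [|exact: C1f|exact: C1radial2].
  congr (_ * _ + _); rewrite C1_deriveB//; last first.
    by apply: C1M (C1_cst _); apply: C1B C1_snd (C1_cst _).
  rewrite C1_deriveM; [|by apply: C1B C1_snd (C1_cst _)|exact: C1_cst].
  rewrite C1_deriveB; [|exact: C1_snd|exact: C1_cst].
  by rewrite derive_snd !derive_cst/= subr0 mulr0 add0r mulr1.
rewrite /divergence d1 d2 /partial1 /partial2 !derive_f/= -/(f n x).
set t := n%:R * q x.
have := mul_derive_cutoff t; rewrite -/(f n x) => errE.
have k_le0 : derive1 cutoff t <= 0.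
  rewrite derive_cutoff oppr_le0 mulr_ge0 ?sqr_ge0// mulr_ge0//.
  by rewrite le_max lexx orbT.
have pE := phi_sqr_le1 x.
move: errE k_le0; set k := derive1 cutoff t; set v := cutoff t.
set r := R^-1; set y1 := x.1 - c.1; set y2 := x.2 - c.2.
move: pE; set p1 := (phi x).1; set p2 := (phi x).2 => pE errE k_le0.
have fE : f n x = 1 - v by [].
rewrite !fE in errE *; have [qx|qx] := leP (q x) 0.
  have tmax : Num.max t 0 = 0 by rewrite max_r// mulr_ge0_le0.
  have -> : k = 0 by rewrite /k derive_cutoff tmax mulr0 mul0r oppr0.
  have -> : v = 1 by rewrite /v cutoff_le0// mulr_ge0_le0.
  by lra.
(* The boundary term is at most its value for the calibrating field because
   [(x - c) . phi x <= R] in the ball. *)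
have e : (q x + (y1 * y1 + y2 * y2)) * r = R.
  by rewrite /ball_power -/y1 -/y2 subrK mulfK// gt_eqF.
have yp : y1 * p1 + y2 * p2 <= R.
  rewrite -(ler_pM2l R0); have := ler_wpM2l (ltW (mulr_gt0 R0 R0)) pE.
  (* The two squares bound [2 R (y . p)] by [|y|^2 + R^2 |p|^2], and both terms are at most [R^2] in
     the ball. *)
  have := sqr_ge0 (y1 - R * p1); have := sqr_ge0 (y2 - R * p2).
  by move: qx; rewrite /ball_power -/y1 -/y2; lra.
have nk : 0 <= n%:R * - k * (R - (y1 * p1 + y2 * p2)).
  by rewrite !mulr_ge0// ?oppr_ge0// subr_ge0.
have e' : n%:R * k * ((q x + (y1 * y1 + y2 * y2)) * r) = n%:R * k * R.
  by rewrite e.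
have tmax : Num.max t 0 = n%:R * q x by rewrite max_l// mulr_ge0// ltW.
have err' : - (n%:R * q x * k) * r = 2 * (v * (1 - v)) * r by rewrite -errE tmax.
by lra.
Qed.

(** Inside the ball the field is a convex combination of [phi] and [(x - c) / R], both of norm at
    most 1 there; elsewhere it is [phi]. *)
Lemma test_field_damped n : test_field (fun x => phi x + damped n x).
Proof.
case: (tphi) => phi1 phi2 cphi _; split.
- exact: C1D phi1 (C1_damped1 n).
- exact: C1D phi2 (C1_damped2 n).
- have [M phiM] := compact_support_norm _ 0 phi cphi.
  apply: (norm_compact_support _ _ _ (Num.max M (`|c| + R))) => x.
  by rewrite gt_max => /andP[/phiM -> /damped_supp ->]; rewrite addr0.
move=> x; rewrite /enorm -[X in _ <= X]sqrtr1 ler_sqrt//=.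
have := phi_sqr_le1 x; set p1 := (phi x).1; set p2 := (phi x).2 => p_le1.
have [qx|qx] := leP (q x) 0; first by rewrite f0// !mul0r !addr0.
set u1 := (x.1 - c.1) / R; set u2 := (x.2 - c.2) / R.
have u_le1 : u1 ^+ 2 + u2 ^+ 2 <= 1.
  rewrite !expr_div_n -mulrDl ler_pdivrMr ?exprn_gt0// mul1r.
  by move: qx; rewrite /ball_power; lra.
have := f_ge0 n x; have := f_le1 n x; set a := f n x => a1 a0.
have a1' : 0 <= 1 - a by rewrite subr_ge0.
(* The quantities in [h1], [h2] and [h3] add up to 1 minus the squared norm of [(1 - a) p + a u]. *)
have h1 : 0 <= a * (1 - a) * ((u1 - p1) ^+ 2 + (u2 - p2) ^+ 2).
  by rewrite !mulr_ge0// addr_ge0// sqr_ge0.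
have h2 : 0 <= (1 - a) * (1 - (p1 ^+ 2 + p2 ^+ 2)).
  by rewrite mulr_ge0// subr_ge0.
have h3 : 0 <= a * (1 - (u1 ^+ 2 + u2 ^+ 2)) by rewrite mulr_ge0// subr_ge0.
by lra.
Qed.

End calibration.

(** * Perimeter and energy *)

Section perimeter.
Context {K : realType}.
Implicit Types (A B S : set (K * K)) (f : K * K -> K) (phi : K * K -> K * K).

Lemma measurable_indicM A f : lebesgue_measurable A -> continuous f ->
  measurable_fun setT ((fun x => \1_A x * f x) : lebesgue_plane K -> K).
Proof.
move=> mA cf; apply: measurable_funM; first exact: measurable_indic.
exact: continuous_plane_measurable.
Qed.

Lemma normr_indicM_le A f x : `|\1_A x * f x| <= `|f x|.
Proof.
rewrite normrM ler_piMl// indicE.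
by case: (x \in A); rewrite ?normr1 ?normr0.
Qed.

Lemma integrable_indicM A f (M : K) : lebesgue_measurable A -> continuous f ->
  (forall x, M < `|x| -> f x = 0) ->
  (area K).-integrable setT (fun x => (\1_A x * f x)%:E).
Proof.
move=> mA cf fM; have [C fC] := bounded_continuous_supp f M cf fM.
apply: (integrable_plane (fun x => \1_A x * f x) C M).
- exact: measurable_indicM.
- by move=> x; exact: le_trans (normr_indicM_le A f x) (fC x).
- by move=> x /fM ->; rewrite mulr0.
Qed.

Lemma continuous_divergence phi : C1 (fst \o phi) -> C1 (snd \o phi) ->
  continuous (divergence phi).
Proof. by move=> [_ c1 _] [_ _ c2] x; exact: cvgD (c1 x) (c2 x). Qed.

Lemma divergence_supp phi (M : K) : (forall x, M < `|x| -> phi x = 0) ->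
  forall x, M < `|x| -> divergence phi x = 0.
Proof.
move=> phiM x Mx; rewrite /divergence /partial1 /partial2.
by rewrite !(derive_supp _ M)// ?addr0// => y /phiM /= ->.
Qed.

Lemma divergenceD phi psi x : C1 (fst \o phi) -> C1 (snd \o phi) ->
  C1 (fst \o psi) -> C1 (snd \o psi) ->
  divergence (fun y => phi y + psi y) x = divergence phi x + divergence psi x.
Proof.
move=> phi1 phi2 psi1 psi2; rewrite /divergence addrACA.
congr (_ + _); first exact: C1_deriveD phi1 psi1.
exact: C1_deriveD phi2 psi2.
Qed.

Lemma le_perimeter A phi : test_field phi ->
  (\int[area K]_x (\1_A x * divergence phi x)%:E <= perimeter A)%E.
Proof. by move=> tphi; apply: ereal_sup_ubound; exists phi. Qed.

Lemma test_fieldN phi : test_field phi -> test_field (fun x => - phi x).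
Proof.
case=> phi1 phi2 cphi phi_le1; split.
- exact: C1N phi1.
- exact: C1N phi2.
- rewrite (_ : [set x | _] = [set x | phi x != 0])//.
  by apply/seteqP; split=> x /=; rewrite oppr_eq0.
- by move=> x; have := phi_le1 x; rewrite /enorm /= !sqrrN.
Qed.

Lemma divergenceN phi x : C1 (fst \o phi) -> C1 (snd \o phi) ->
  divergence (fun y => - phi y) x = - divergence phi x.
Proof.
move=> phi1 phi2; rewrite /divergence opprD.
congr (_ + _); first exact: C1_deriveN phi1.
exact: C1_deriveN phi2.
Qed.

(** The indicator of the complement is 1 minus that of [A], and [divergence phi] has integral 0, so
    testing the complement with [phi] amounts to testing [A] with [- phi]. *)
Let perimeter_setC_le A : lebesgue_measurable A ->
  (perimeter (~` A) <= perimeter A)%E.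
Proof.
move=> mA; apply: ge_ereal_sup => _ [phi tphi <-].
have [phi1 phi2 cphi _] := tphi.
have [M phiM] := compact_support_norm _ 0 _ cphi.
have divM := divergence_supp _ _ phiM.
have cdiv := continuous_divergence _ phi1 phi2.
have tNphi := test_fieldN _ tphi.
have [Nphi1 Nphi2 _ _] := tNphi.
have cdivN := continuous_divergence _ Nphi1 Nphi2.
have divNM : forall x, M < `|x| -> divergence (fun y => - phi y) x = 0.
  by apply: divergence_supp => x /phiM ->; rewrite oppr0.
rewrite (_ : \int[area K]_x _ =
    \int[area K]_x (\1_A x * divergence (fun y => - phi y) x)%:E)%E.
  exact: le_perimeter.
transitivity (\int[area K]_x ((divergence phi x)%:E +
    (\1_A x * divergence (fun y => - phi y) x)%:E))%E.
  apply: eq_integral => x _; rewrite -EFinD divergenceN//; congr EFin.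
  by rewrite !indicE in_setC; case: (x \in A) => /=; lra.
rewrite integralD//; [|exact: integrable_continuous_supp cdiv divM|
  exact: integrable_indicM mA cdivN divNM].
by rewrite (integral_divergence _ M)// add0e.
Qed.

Lemma perimeter_setC A : lebesgue_measurable A ->
  perimeter (~` A) = perimeter A.
Proof.
move=> mA; apply/eqP; rewrite eq_le perimeter_setC_le//=.
rewrite -[X in (perimeter X <= _)%E]setCK perimeter_setC_le//.
exact: (@measurableC _ (lebesgue_plane K)).
Qed.

Lemma perimeter_setU_ball (c : K * K) (R : K) B S : 0 < R ->
  lebesgue_measurable B -> lebesgue_measurable S ->
  open_eball c R `<=` B -> B `<=` closed_eball c R ->
  (perimeter (B `|` S) <= perimeter S + (2 / R)%:E * area K (B `\` S))%E.
Proof.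
move=> R0 mB mS oB Bc; apply: ge_ereal_sup => _ [phi tphi <-].
have [phi1 phi2 cphi _] := tphi.
have [M phiM] := compact_support_norm _ 0 _ cphi.
have divM := divergence_supp _ _ phiM.
have cdiv := continuous_divergence _ phi1 phi2.
have [C divC] := bounded_continuous_supp _ _ cdiv divM.
pose q := ball_power c R.
have cq : continuous q by exact: continuous_ball_power.
have mCS : lebesgue_measurable (~` S).
  exact: (@measurableC _ (lebesgue_plane K)).
have mBS : lebesgue_measurable (B `\` S).
  exact: (@measurableD _ (lebesgue_plane K)).
pose N := `|c| + R.
have qN x : N < `|x| -> q x <= 0 by move=> /(ball_power_lt0 _ _ R0)/ltW.
have BN x : N < `|x| -> ~ B x.
  move=> /(ball_power_lt0 _ _ R0) qx /Bc /(closed_eballE _ _ R0).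
  by rewrite leNgt qx.
(* The bound from [divergence_damped]. It is integrated off [S]: the total divergence being 0, an
   upper bound there is a lower bound on [S]. *)
pose h n x := (1 - cutoff (n%:R * q x)) * (2 / R - divergence phi x) +
  4 / R * (cutoff (n%:R * q x) * (1 - cutoff (n%:R * q x))).
have h0 n x : q x <= 0 -> h n x = 0.
  by move=> qx; rewrite /h cutoff_le0 ?mulr_ge0_le0// subrr !mulr0 mul0r addr0.
have ccut n : continuous (fun x => cutoff (n%:R * q x)).
  have cnq : continuous (fun x => n%:R * q x).
    by move=> x; apply: cvgM; [exact: cvg_cst|exact: cq].
  move=> x; apply: (@continuous_comp _ _ _ (fun x => n%:R * q x) cutoff).
    exact: cnq.
  exact: continuous_cutoff.
have ch n : continuous (h n).
  move=> x; have c1 := cvgB (cvg_cst (1 : K)) (ccut n x).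
  apply: cvgD.
    by apply: cvgM; [exact: c1|apply: cvgB; [exact: cvg_cst|exact: cdiv]].
  by apply: cvgM; [exact: cvg_cst|apply: cvgM; [exact: ccut|exact: c1]].
pose G n x := \1_(~` S) x * h n x.
(* In the limit the weight becomes the indicator of [B] almost everywhere and the error term
   disappears. *)
pose G_lim x := \1_(B `\` S) x * (2 / R - divergence phi x).
have mG n : measurable_fun setT (G n : lebesgue_plane K -> K).
  exact: measurable_indicM.
have mG_lim : measurable_fun setT (G_lim : lebesgue_plane K -> K).
  apply: measurable_indicM => // x.
  by apply: cvgB; [exact: cvg_cst|exact: cdiv].
have intG n : (area K).-integrable setT (EFin \o (G n : lebesgue_plane K -> K)).
  by apply: integrable_indicM (ch n) _ => // x /qN; exact: h0.
have intS : (area K).-integrable setT (fun x => (\1_S x * divergence phi x)%:E).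
  exact: integrable_indicM cdiv divM.
(* The summands bound [2 / R], [divergence phi] and the error term, whose factor [v * (1 - v)] is at
   most 1. *)
pose D := 2 / R + C + 4 / R.
have hD n x : `|h n x| <= D.
  have := cutoff_le1 (n%:R * q x); have := cutoff_gt0 (n%:R * q x).
  rewrite /h; set v := cutoff _ => v0 v1.
  have v1' : 0 <= 1 - v by rewrite subr_ge0.
  rewrite (le_trans (ler_normD _ _))// lerD//.
    rewrite normrM ger0_norm// (@le_trans _ _ `|2 / R - divergence phi x|)//.
      by rewrite ler_piMl// gerBl ltW.
    rewrite (le_trans (ler_normB _ _))// lerD//.
    by rewrite ger0_norm// divr_ge0// ltW.
  have r0 : 0 <= 4 / R by rewrite divr_ge0// ltW.
  have vv0 : 0 <= v * (1 - v) by rewrite mulr_ge0// ltW.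
  rewrite ger0_norm; last exact: mulr_ge0.
  by rewrite ler_piMr//; have := sqr_ge0 v; lra.
have D0 : 0 <= D by exact: le_trans (normr_ge0 _) (hD 0 0).
have [||||| intG_lim _ cvgG] := @dominated_convergence _ (lebesgue_plane K) K
    (area K) setT measurableT (fun n x => (G n x)%:E) (fun x => (G_lim x)%:E)
    (fun x => (\1_[set y : K * K | `|y| <= N] x * D)%:E).
- by move=> n; apply/measurable_EFinP.
- exact/measurable_EFinP.
(* The circle is discarded: there [h n] is 0 for all [n], whereas [B] may contain any part of it. *)
- apply: (@negligibleS _ _ _ _ _ _ _ (sphere_negligible c R)) => x /= nGx.
  apply: contrapT => qx; apply: nGx => _.
  apply: cvg_EFin; first exact: nearW.
  have [q0|q0] := ltP 0 (q x).
    have Bx : B x by apply: oB; apply/(open_eballE _ _ R0).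
    (* The limit is written as [h] with the cutoff replaced by its limit 0, to match the limit rules
       term by term. *)
    have -> : G_lim x = \1_(~` S) x * ((1 - 0) * (2 / R - divergence phi x) +
        4 / R * (0 * (1 - 0))).
      rewrite /G_lim subr0 mul1r mul0r mulr0 addr0 !indicE in_setD in_setC.
      by rewrite (mem_set Bx).
    have c1 := cvg_cutoff _ q0; have c2 := cvgB (cvg_cst (1 : K)) c1.
    apply: cvgM; first exact: cvg_cst.
    apply: cvgD; first by apply: cvgM; [exact: c2|exact: cvg_cst].
    by apply: cvgM; [exact: cvg_cst|apply: cvgM; [exact: c1|exact: c2]].
  have Bx : ~ B x.
    by move=> /Bc /(closed_eballE _ _ R0) q0'; apply: qx; apply/eqP; rewrite eq_le q0 q0'.
  rewrite /G_lim indicE in_setD memNset//= mul0r.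
  rewrite (_ : (fun n => _) = fun=> 0); first exact: cvg_cst.
  by apply/funext => n; rewrite /G /= h0// mulr0.
- apply: (integrable_plane (fun x => \1_[set y : K * K | `|y| <= N] x * D) D N).
  + by apply: measurable_indicM; [exact: measurable_norm_le|exact: cst_continuous].
  + by move=> x; rewrite (le_trans (normr_indicM_le _ (fun=> D) _))// ger0_norm.
  + by move=> x Nx; rewrite indicE memNset ?mul0r//= leNgt Nx.
- apply: aeW => x n _; rewrite lee_fin.
  have [xN|/qN qx] := leP `|x| N; last by rewrite /G h0// mulr0 normr0 mulr_ge0.
  rewrite indicE mem_set//= mul1r.
  exact: le_trans (normr_indicM_le _ _ _) (hD n x).
(* The integral of the divergence of the damped field is 0 and is added for free. The integrands
   then agree on [S], and off [S] their comparison is [divergence_damped]. *)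
have step n : (\int[area K]_x (\1_S x * divergence phi x)%:E -
    \int[area K]_x (G n x)%:E <= perimeter S)%E.
  have tpsi := test_field_damped c R R0 phi tphi n.
  have w1 := C1_damped1 c R phi tphi n; have w2 := C1_damped2 c R phi tphi n.
  have wN := damped_supp c R R0 phi n.
  have intw := integrable_continuous_supp _ _
    (continuous_divergence _ w1 w2) (divergence_supp _ _ wN).
  have [psi1 psi2 /(compact_support_norm _ 0)[M' psiM'] _] := tpsi.
  have intpsi := integrable_indicM S _ _ mS
    (continuous_divergence _ psi1 psi2) (divergence_supp _ _ psiM').
  have intSw := integrableD measurableT intS intw.
  have intSG := integrableB measurableT intSw (intG n).
  apply: le_trans (le_perimeter S _ tpsi).
  rewrite -[X in (X - _)%E]adde0 -(integral_divergence _ _ w1 w2 wN).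
  rewrite -integralD// -integralB//; last exact: intG.
  apply: le_integral => //.
  move=> x _; rewrite /= lee_fin divergenceD// /G !indicE in_setC.
  have := divergence_damped c R R0 phi tphi n x; rewrite -/(h n x).
  by case: (x \in S) => /=; lra.
have finS := integrable_fin_num measurableT intS.
have fin_lim := integrable_fin_num measurableT intG_lim.
have lim_le : (\int[area K]_x (\1_S x * divergence phi x)%:E -
    \int[area K]_x (G_lim x)%:E <= perimeter S)%E.
  have cvgS : (\int[area K]_x (\1_S x * divergence phi x)%:E -
      \int[area K]_x (G n x)%:E @[n --> \oo] -->
      \int[area K]_x (\1_S x * divergence phi x)%:E -
      \int[area K]_x (G_lim x)%:E)%E.
    apply: cvgeB => //; first exact: fin_num_adde_defr.
    exact: cvg_cst.
  rewrite -(cvg_lim _ cvgS)//; apply: lime_le; first exact: cvgP cvgS.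
  by apply: nearW => k; exact: step.
have intBS : (area K).-integrable setT (fun x => (2 / R * \1_(B `\` S) x)%:E).
  have mcBS := measurable_indicM _ _ mBS (@cst_continuous _ _ (2 / R)).
  under eq_fun do rewrite mulrC.
  apply: (integrable_plane _ `|2 / R| N mcBS).
    by move=> x; exact: normr_indicM_le (fun=> 2 / R) _.
  move=> x /BN Bx; rewrite indicE memNset ?mul0r//.
  by case.
apply: le_trans (leeD2r _ lim_le).
(* Equality holds: on the part of [B] outside [S] the two terms [2 / R] cancel and leave
   [divergence phi]. *)
rewrite le_eqVlt; apply/orP; left; apply/eqP.
transitivity (\int[area K]_x ((\1_S x * divergence phi x)%:E - (G_lim x)%:E +
    (2 / R * \1_(B `\` S) x)%:E))%E.
  apply: eq_integral => x _; rewrite -EFinB -EFinD; congr EFin.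
  rewrite /G_lim !indicE in_setU in_setD.
  by case: (x \in B); case: (x \in S) => /=; lra.
rewrite integralD//; last exact: integrableB.
rewrite integralB//; congr (_ + _)%E.
under eq_integral do rewrite EFinM.
rewrite ge0_integralZl//.
- by rewrite integral_indic// setIT.
- exact/measurable_EFinP/measurable_indic.
- by rewrite lee_fin divr_ge0// ltW.
Qed.

End perimeter.

Section energy.
Context {K : realType}.
Implicit Types (lambda : K) (A B Omega Sigma : set (K * K)).

(** Complementing both sets changes neither the perimeter nor the symmetric difference. *)
Lemma energy_setC lambda Omega Sigma : lebesgue_measurable Sigma ->
  energy lambda (~` Omega) (~` Sigma) = energy lambda Omega Sigma.
Proof.
move=> mS; rewrite /energy perimeter_setC//; congr (_ + _ * area K _)%E.
apply/seteqP; split=> x; rewrite /setY/=;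
  by have [Sx|Sx] := pselect (Sigma x); have [Ox|Ox] := pselect (Omega x); tauto.
Qed.

Lemma minimizer_setC lambda Omega Sigma :
  minimizer lambda Omega Sigma -> minimizer lambda (~` Omega) (~` Sigma).
Proof.
case=> mS minS; split; first exact: (@measurableC _ (lebesgue_plane K)).
move=> S' mS'; rewrite energy_setC// -[S']setCK.
have mCS' : lebesgue_measurable (~` S').
  exact: (@measurableC _ (lebesgue_plane K)).
by rewrite energy_setC//; exact: minS.
Qed.

Lemma minimizer_setU_ball lambda Omega Sigma (c : K * K) B :
  0 < lambda -> lebesgue_measurable Omega -> lebesgue_measurable B ->
  minimizer lambda Omega Sigma ->
  open_eball c (2 / lambda) `<=` B -> B `<=` closed_eball c (2 / lambda) ->
  B `<=` Omega -> minimizer lambda Omega (B `|` Sigma).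
Proof.
move=> l0 mO mB [mS minS] oB Bc BO.
have mBS : lebesgue_measurable (B `|` Sigma).
  exact: (@measurableU _ (lebesgue_plane K)).
split=> // S' mS'; apply: le_trans (minS _ mS').
have mDiff A A' : lebesgue_measurable A -> lebesgue_measurable A' ->
    lebesgue_measurable (A `\` A').
  exact: (@measurableD _ (lebesgue_plane K)).
(* As [B] lies in [Omega], the symmetric difference of [Sigma] and [Omega] is the disjoint union of
   [B] minus [Sigma] and the symmetric difference of the enlarged set with [Omega]. *)
have -> : energy lambda Omega Sigma = (perimeter Sigma +
    lambda%:E * area K (B `\` Sigma) +
    lambda%:E * area K ((B `|` Sigma) `+` Omega))%E.
  rewrite /energy -addeA -ge0_muleDr ?measure_ge0//; congr (_ + _ * _)%E.
  rewrite -measureU; [|exact: mDiff|apply: (@measurableU _ (lebesgue_plane K)); exact: mDiff|].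
  - congr (area K _); apply/seteqP; split=> x; rewrite /setY/=.
      case=> -[Sx Ox]; first by right; left; split=> //; right.
      have [Bx|Bx] := pselect (B x); first by left.
      by right; right; split=> // -[].
    case=> [[Bx Sx]|]; first by right; split=> //; exact: BO.
    case=> [[[Bx|Sx] Ox]|[Ox nBS]].
    - by exfalso; exact/Ox/BO.
    - by left.
    - by right; split=> // Sx; apply: nBS; right.
  - apply/seteqP; split=> // x [[Bx Sx]]; rewrite /setY/=.
    case=> [[_ Ox]|[_ nBS]]; first exact/Ox/BO.
    by apply: nBS; left.
rewrite /energy leeD2r//.
(* For the radius [2 / lambda] the factor [2 / R] is [lambda], so the perimeter bound matches the
   area gained. *)
have := perimeter_setU_ball c (2 / lambda) B Sigma _ mB mS oB Bc.
by rewrite invf_div mulrCA divff ?gt_eqF// mulr1; apply; rewrite divr_gt0.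
Qed.

End energy.

Theorem theorem1 (K : realType) (lambda : K) (Omega Sigma : set (K * K))
    (c : K * K) (B : set (K * K)) :
  0 < lambda ->
  bounded_set Omega ->
  lebesgue_measurable Omega ->
  minimizer lambda Omega Sigma ->
  B = open_eball c (2 / lambda) \/ B = closed_eball c (2 / lambda) ->
  (B `<=` Omega -> minimizer lambda Omega (B `|` Sigma)) /\
  (B `<=` ~` Omega -> minimizer lambda Omega (~` (B `|` ~` Sigma))).
Proof.
move=> l0 _ mO minS hB.
have R0 : 0 < 2 / lambda by rewrite divr_gt0.
have sub : open_eball c (2 / lambda) `<=` closed_eball c (2 / lambda).
  by move=> x /ltW.
have [mB oB Bc] : [/\ lebesgue_measurable B, open_eball c (2 / lambda) `<=` B &
    B `<=` closed_eball c (2 / lambda)].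
  case: hB => ->; split=> //.
    exact: lebesgue_measurable_open_eball.
  exact: lebesgue_measurable_closed_eball.
split=> [BO|BO]; first exact: (minimizer_setU_ball _ _ _ c).
rewrite -(setCK Omega); apply: minimizer_setC.
apply: (minimizer_setU_ball _ _ _ c) => //.
  exact: (@measurableC _ (lebesgue_plane K)).
exact: minimizer_setC.
Qed.
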